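(* Let $1<p,q<\infty$. There is a constant $0<C=C(p,q)<\infty$ such that for every $M,N\in\mathbb N$ and every complex $M\times N$ matrix $A$, $$\frac1C\, h_p(A)\le h_q^w(A)\le h_q(A)\le C\, h_p(A).$$
   Context: Let $(\Omega,\Sigma,\mathbb P)$ be a probability space with a dyadic filtration $(\Sigma_k)_{k\ge0}$, i.e. an increasing sequence of sub-$\sigma$-algebras of $\Sigma$ such that each $\Sigma_k$ is atomic with exactly $2^k$ atoms, each of probability $2^{-k}$. Let $\mathcal E_kf=\mathbb E(f\mid\Sigma_k)$ and $\Delta_kf=\mathcal E_kf-\mathcal E_{k-1}f$ for $k\ge1$. For a complex $M\times N$ matrix $A=(a_{jk})$ and $1\le p<\infty$, $h_p(A)$ is the least constant such that $\big\|\max_{1\le j\le M}|\sum_{k=1}^N a_{jk}\Delta_kf|\big\|_{L_p}\le h_p(A)\|f\|_{L_p}$ for all $f\in L_p(\Omega)$, and $h_p^w(A)$ is the least constant such that $\big\|\max_{1\le j\le M}|\sum_{k=1}^N a_{jk}\Delta_kf|\big\|_{L_{p,\infty}}\le h_p^w(A)\|f\|_{L_p}$ for all $f\in L_p(\Omega)$ ($L_{p,\infty}$ is weak $L_p$). These constants do not depend on the choice of probability space and dyadic filtration. *)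

(* Defs.v *)
From HB Require Import structures.
From mathcomp Require Import all_boot all_order all_algebra.
From mathcomp Require Import all_classical all_reals all_analysis.
From mathcomp Require Import complex.

Set Implicit Arguments.
Unset Strict Implicit.
Unset Printing Implicit Defensive.

Import Order.TTheory GRing.Theory Num.Theory.
Local Open Scope classical_set_scope.
Local Open Scope ring_scope.

(* We realize the (arbitrary, by the context) probability space with dyadic
   filtration as the standard one: Omega = [0,1) with Lebesgue measure and
   Sigma_k generated by the 2^k dyadic intervals [j 2^-k, (j+1) 2^-k). *)

Section Dyadic.
Context {R : realType}.

Definition cmod (z : R[i]) : R := Num.sqrt (complex.Re z ^+ 2 + complex.Im z ^+ 2).

Definition Omega : set R := `[0%R, 1%R[.


Definition dyad_left (k : nat) (x : R) : R :=
  (Num.floor (2 ^+ k * x))%:~R / 2 ^+ k.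

Definition dyad_atom (k : nat) (x : R) : set R :=
  `[dyad_left k x, dyad_left k x + (2 ^+ k)^-1[.

(* E_k f = E(f | Sigma_k): average of f over the atom of Sigma_k containing x
   (each atom has probability 2^-k) ; complex f is handled componentwise *)
Definition cond_exp (k : nat) (f : R -> R[i]) (x : R) : R[i] :=
  Complex (2 ^+ k * Rintegral (@lebesgue_measure R) (dyad_atom k x) (fun y => complex.Re (f y)))
          (2 ^+ k * Rintegral (@lebesgue_measure R) (dyad_atom k x) (fun y => complex.Im (f y))).

(* Delta_k f = E_k f - E_{k-1} f  (used for k >= 1) *)
Definition mart_diff (k : nat) (f : R -> R[i]) (x : R) : R[i] :=
  cond_exp k f x - cond_exp k.-1 f x.

(* x |-> max_{1<=j<=M} | sum_{k=1}^N a_{jk} Delta_k f (x) |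
   (column k' : 'I_N of A corresponds to k = k'+1) *)
Definition max_transform (M N : nat) (A : 'M[R[i]]_(M, N)) (f : R -> R[i])
    (x : R) : R :=
  \big[Num.max/0]_(j < M) cmod (\sum_(k < N) A j k * mart_diff k.+1 f x).

Definition Lp_norm (p : R) (g : R -> R) : \bar R :=
  ((\int[@lebesgue_measure R]_(x in Omega) ((`|g x| `^ p)%:E)) `^ p^-1)%E.

Definition weakLp_norm (p : R) (g : R -> R) : \bar R :=
  ereal_sup [set (t%:E * (lebesgue_measure (Omega `&` [set x | (t < `|g x|)%R]))
                          `^ p^-1)%E | t in [set t : R | (0 < t)%R]].

Definition in_Lp (p : R) (f : R -> R[i]) : Prop :=
  [/\ measurable_fun Omega (fun x => complex.Re (f x)),
      measurable_fun Omega (fun x => complex.Im (f x)) &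
      (Lp_norm p (fun x => cmod (f x)) < +oo)%E].

Definition h_strong (p : R) (M N : nat) (A : 'M[R[i]]_(M, N)) : \bar R :=
  ereal_inf [set c%:E | c in [set c : R | 0 <= c /\
     forall f, in_Lp p f ->
       (Lp_norm p (max_transform A f) <= c%:E * Lp_norm p (fun x => cmod (f x)))%E]].

Definition h_weak (p : R) (M N : nat) (A : 'M[R[i]]_(M, N)) : \bar R :=
  ereal_inf [set c%:E | c in [set c : R | 0 <= c /\
     forall f, in_Lp p f ->
       (weakLp_norm p (max_transform A f) <= c%:E * Lp_norm p (fun x => cmod (f x)))%E]].

End Dyadic.

(* Main.v *)
(* A function only enters through its averages over the dyadic cells of level
   [N], so everything happens on a finite set carrying a dyadic filtration.
   There, conditioning a stopped function stops its martingale, so the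
   truncated transforms commute with stopping times:
   - stopping when the averages of [|F|] exceed a level is the Calderon-Zygmund
     decomposition, and turns weak type (q,q) into weak type (1,1);
   - stopping when a truncated transform exceeds a level carries weak type (1,1)
     over to the maximal truncated transform and, by regularity of the
     filtration, to its predictable majorant [X];
   - subtracting from [F] its stopped version at the first time [X] exceeds [t]
     gives [t * #{X > 2 t} <= C * sum of |F| over {X > t}].
   Summing the last estimate over the levels [t = d 2^k] yields the strong type
   (p,p) bound for every [p > 1]. *)

Require Import Defs.
From HB Require Import structures.
From mathcomp Require Import all_boot all_order all_algebra.
From mathcomp Require Import all_classical all_reals all_analysis.
From mathcomp Require Import complex.
From mathcomp Require Import measurable_realfun ring lra.

Set Implicit Arguments.
Unset Strict Implicit.
Unset Printing Implicit Defensive.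

Import Order.TTheory GRing.Theory Num.Theory.
Local Open Scope ring_scope.

(** * From a good-lambda estimate to norms *)

Section GoodLambda.
Context {R : realType}.

(** Either [y <= e * x], and the first term suffices, or [x < e^-1 * y], and the second does. The
    free parameter [e] lets the [x] term be absorbed later. *)
Lemma powR_young_crude (p e x y : R) : 1 < p -> 0 < e -> 0 <= x -> 0 <= y ->
  x `^ (p - 1) * y <= e * x `^ p + e `^ (1 - p) * y `^ p.
Proof.
move=> p1 e0 x0 y0.
have powS (z : R) : 0 <= z -> z `^ p = z `^ (p - 1) * z.
  by move=> z0; rewrite mulrC mulr_powRB1//; lra.
have [yx|xy] := leP y (e * x).
  apply: (@le_trans _ _ (e * x `^ p)).
    by rewrite (powS _ x0) mulrCA ler_wpM2l ?powR_ge0.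
  by rewrite lerDl mulr_ge0 ?powR_ge0.
apply: (@le_trans _ _ (e `^ (1 - p) * y `^ p)); last first.
  by rewrite lerDr mulr_ge0 ?powR_ge0 ?ltW.
rewrite (powS _ y0) mulrA ler_wpM2r//.
have xle : x <= e^-1 * y by rewrite mulrC ler_pdivlMr// mulrC ltW.
have -> : e `^ (1 - p) = e^-1 `^ (p - 1).
  by rewrite -powR_inv1 ?ltW// -powRrM mulN1r opprB.
rewrite -powRM ?invr_ge0 ?(ltW e0)//.
by apply: ge0_ler_powR; rewrite ?nnegrE ?mulr_ge0 ?invr_ge0 ?(ltW e0)//; lra.
Qed.

Lemma powR2_gt1 (s : R) : 0 < s -> 1 < 2 `^ s :> R.
Proof.
move=> s0; have : (1 : R) `^ s < 2 `^ s.
  by apply: gt0_ltr_powR; rewrite ?nnegrE// ltr1n.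
by rewrite powR1.
Qed.

Lemma powR_exprn (a s : R) k : 0 <= a -> (a ^+ k) `^ s = (a `^ s) ^+ k.
Proof.
move=> a0; rewrite -(@powR_mulrn _ (a `^ s) k); last exact: powR_ge0.
rewrite -(@powR_mulrn _ a k a0).
by rewrite -powRrM -powRrM mulrC.
Qed.

Lemma sum_geometric_le (r : R) n : 1 < r ->
  \sum_(k < n.+1) r ^+ k <= r / (r - 1) * r ^+ n.
Proof.
move=> r1; have r1' : 0 < r - 1 by rewrite subr_gt0.
rewrite mulrAC ler_pdivlMr// mulrC -subrX1 -exprS.
by rewrite lerBlDr lerDl.
Qed.

(** The sum is geometric, hence comparable to its largest term, and the largest level that counts
    lies below [x]. *)
Lemma sum_levels_below (r d s x : R) n : 0 < s -> 0 < d -> r = 2 `^ s ->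
  \sum_(k < n) (d * 2 ^+ k) `^ s * (d * 2 ^+ k < x)%R%:R
    <= r / (r - 1) * x `^ s.
Proof.
move=> s0 d0 rE.
have r1 : 1 < r by rewrite rE; exact: powR2_gt1.
have c0 : 0 <= r / (r - 1) by rewrite divr_ge0; lra.
elim: n => [|n IH]; first by rewrite big_ord0 mulr_ge0 ?powR_ge0.
have [xgt|xle] := ltP (d * 2 ^+ n) x; last first.
  by rewrite big_ord_recr/= ltNge xle/= mulr0 addr0.
apply: (@le_trans _ _ (r / (r - 1) * (d * 2 ^+ n) `^ s)); last first.
  rewrite ler_wpM2l//; apply: ge0_ler_powR; rewrite ?nnegrE ?(ltW s0) ?(ltW xgt)//.
    by rewrite mulr_ge0 ?exprn_ge0 ?ltW.
  by rewrite (le_trans _ (ltW xgt))// mulr_ge0 ?exprn_ge0 ?ltW.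
have lvl k : (d * 2 ^+ k) `^ s = d `^ s * r ^+ k.
  rewrite powRM ?exprn_ge0 ?(ltW d0)// rE; congr (_ * _).
  exact: powR_exprn.
rewrite lvl mulrCA.
apply: (@le_trans _ _ (\sum_(k < n.+1) d `^ s * r ^+ k)).
  apply: ler_sum => k _; rewrite lvl; case: ltP => _; rewrite ?mulr1// mulr0.
  by rewrite mulr_ge0 ?powR_ge0 ?exprn_ge0//; lra.
by rewrite -mulr_sumr ler_wpM2l ?powR_ge0 ?sum_geometric_le.
Qed.

(** Either [x <= 2 * d], or [x] lies between [2 * (d * 2 ^+ k)] and twice that number for some
    [k < n]; the term of this [k] alone dominates. *)
Lemma powR_le_sum_levels (p d x : R) n : 0 < p -> 0 < d -> 0 <= x ->
  x <= 2 * (d * 2 ^+ n) ->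
  x `^ p <= (2 * d) `^ p +
    \sum_(k < n) (4 * (d * 2 ^+ k)) `^ p * (2 * (d * 2 ^+ k) < x)%R%:R.
Proof.
move=> p0 d0 x0; elim: n => [|n IH] xle.
  rewrite big_ord0 addr0; apply: ge0_ler_powR; rewrite ?nnegrE ?(ltW p0)//; last first.
    by rewrite expr0 mulr1 in xle.
  by rewrite mulr_ge0 ?ltW.
rewrite big_ord_recr/=; case: ltP => [_|xle'].
  rewrite mulr1 addrA -[leLHS]add0r lerD//.
    rewrite addr_ge0 ?powR_ge0 ?sumr_ge0// => k _.
    by rewrite mulr_ge0 ?powR_ge0.
  apply: ge0_ler_powR; rewrite ?nnegrE ?(ltW p0)//.
    by rewrite !mulr_ge0 ?exprn_ge0 ?ltW.
  by apply: le_trans xle _; rewrite exprS; lra.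
by rewrite mulr0 addr0; apply: IH.
Qed.

Lemma good_lambda_norm_le (p K : R) : 1 < p -> 0 < K ->
  exists C : R, 0 < C /\
  forall (T : finType) (X Y : T -> R),
    (forall x, 0 <= X x) -> (forall x, 0 <= Y x) ->
    (forall t, 0 < t ->
      t * \sum_x (2 * t < X x)%R%:R <= K * \sum_x (t < X x)%R%:R * Y x) ->
    \sum_x X x `^ p <= C * \sum_x Y x `^ p.
Proof.
move=> p1 K0; pose r : R := 2 `^ (p - 1).
have s0 : 0 < p - 1 by lra.
have p0 : 0 < p by lra.
have r1 : 1 < r by exact: powR2_gt1.
pose B : R := 4 `^ p * K * (r / (r - 1)).
have B0 : 0 < B.
  by rewrite /B !mulr_gt0 ?powR_gt0 ?invr_gt0 ?subr_gt0// ltr0n.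
(* This gives [B * e = 1 / 2], the share of [S] that is absorbed. *)
pose e : R := (2 * B)^-1.
have e0 : 0 < e by rewrite invr_gt0 mulr_gt0.
exists (2 * B * e `^ (1 - p)); split; first by
  apply: mulr_gt0; [exact: mulr_gt0|exact: powR_gt0].
move=> T X Y X0 Y0 H.
set S := \sum_x X x `^ p.
have step d : 0 < d -> S <= #|T|%:R * (2 * d) `^ p + B * \sum_x X x `^ (p - 1) * Y x.
  move=> d0.
  have [n Hn] : exists n : nat, forall x, X x <= 2 * (d * 2 ^+ n).
    (* The sum of [X] bounds each value, and [m < 2 ^ m] turns an archimedean bound into an
       exponent. *)
    pose s := (\sum_x X x) / (2 * d).
    exists (Num.bound s) => x.
    rewrite mulrA mulrC -ler_pdivrMr ?mulr_gt0//.
    apply: (@le_trans _ _ s).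
      rewrite ler_wpM2r ?invr_ge0 ?mulr_ge0 ?(ltW d0)//.
      by rewrite (bigD1 x)//= lerDl sumr_ge0.
    apply: (@le_trans _ _ (Num.bound s)%:R).
      apply/ltW/archi_boundP; rewrite divr_ge0 ?sumr_ge0 ?mulr_ge0 ?ltW//.
    by rewrite -natrX ler_nat ltnW// ltn_expl.
  apply: (@le_trans _ _ (\sum_x ((2 * d) `^ p +
    \sum_(k < n) (4 * (d * 2 ^+ k)) `^ p * (2 * (d * 2 ^+ k) < X x)%R%:R))).
    by apply: ler_sum => x _; exact: powR_le_sum_levels.
  rewrite big_split/= sumr_const -[X in X + _ <= _]mulr_natl lerD2l.
  rewrite exchange_big/=.
  apply: (@le_trans _ _ (\sum_(k < n) 4 `^ p * K *
      ((d * 2 ^+ k) `^ (p - 1) * \sum_x (d * 2 ^+ k < X x)%R%:R * Y x))).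
    apply: ler_sum => k _; set t := d * 2 ^+ k.
    have t0 : 0 < t by rewrite mulr_gt0 ?exprn_gt0.
    rewrite -mulr_sumr powRM ?(ltW t0)// -!mulrA ler_wpM2l ?powR_ge0//.
    have -> : t `^ p = t `^ (p - 1) * t.
      by rewrite mulrC mulr_powRB1// ltW.
    rewrite -mulrA [leRHS]mulrCA ler_wpM2l ?powR_ge0//.
    exact: H.
  rewrite -mulr_sumr /B -[leRHS]mulrA ler_wpM2l ?mulr_ge0 ?powR_ge0 ?(ltW K0)//.
  under [leLHS]eq_bigr do rewrite mulr_sumr.
  rewrite exchange_big/= mulr_sumr; apply: ler_sum => x _.
  rewrite mulrA; under eq_bigr do rewrite mulrA.
  rewrite -mulr_suml ler_wpM2r//.
  exact: sum_levels_below.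
clearbody B.
have young : B * \sum_x X x `^ (p - 1) * Y x <=
    2^-1 * S + B * e `^ (1 - p) * \sum_x Y x `^ p.
  have -> : 2^-1 = B * e :> R by rewrite /e; field; rewrite ?gt_eqF//; lra.
  rewrite /S -!mulrA -mulrDr ler_wpM2l ?(ltW B0)//.
  rewrite !mulr_sumr -big_split/=; apply: ler_sum => x _.
  exact: powR_young_crude.
apply/ler_addgt0Pr => eta eta0.
(* Chosen so that the error term is at most [eta / 2]; the added 1 covers an empty [T]. *)
pose d := (eta / (2 * (#|T|%:R + 1))) `^ p^-1 / 2.
have n0 : 0 <= #|T|%:R :> R by [].
have n1 : 0 < #|T|%:R + 1 :> R by lra.
have d0 : 0 < d by rewrite divr_gt0 ?powR_gt0// divr_gt0 ?mulr_gt0.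
have := step d d0.
have -> : (2 * d) `^ p = eta / (2 * (#|T|%:R + 1)).
  rewrite /d mulrC divfK ?pnatr_eq0// -powRrM mulVf ?gt_eqF// powRr1//.
  by rewrite divr_ge0 ?mulr_ge0// ltW.
have : #|T|%:R * (eta / (2 * (#|T|%:R + 1))) <= eta / 2 :> R.
  rewrite mulrA ler_pdivrMr ?mulr_gt0//; nra.
move: young; rewrite -![2 * B * _ * _]mulrA; set Z := \sum_x _; lra.
Qed.

End GoodLambda.

(** * The modulus of a complex number *)

Section Cmod.
Context {R : realType}.
Implicit Types z w : R[i].

Lemma cmodE z : cmod z = Normc.normc z.
Proof. by case: z. Qed.

Lemma cmod_ge0 z : 0 <= cmod z. Proof. exact: sqrtr_ge0. Qed.

Lemma cmod0 : cmod (0 : R[i]) = 0. Proof. by rewrite cmodE Normc.normc0. Qed.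

Lemma cmodM z w : cmod (z * w) = cmod z * cmod w.
Proof. by rewrite !cmodE Normc.normcM. Qed.

Lemma cmodD z w : cmod (z + w) <= cmod z + cmod w.
Proof. by rewrite !cmodE; exact: le_normcD. Qed.

Lemma cmodN z : cmod (- z) = cmod z.
Proof. by rewrite !cmodE; exact: normcN. Qed.

Lemma cmodB z w : cmod (z - w) <= cmod z + cmod w.
Proof. by rewrite -(cmodN w) cmodD. Qed.

Lemma cmodV_nat n : cmod ((n%:R : R[i])^-1) = n%:R^-1.
Proof.
by rewrite cmodE Normc.normcV normcMn Normc.normc1.
Qed.

Lemma cmod_sum (I : finType) (P : pred I) (F : I -> R[i]) :
  cmod (\sum_(i | P i) F i) <= \sum_(i | P i) cmod (F i).
Proof.
elim/big_rec2: _ => [|i y z _ yz]; first by rewrite cmod0.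
by apply: le_trans (cmodD _ _) _; rewrite lerD2l.
Qed.

End Cmod.

(** * Finite regular filtrations *)

(* [l k x] labels the atom of level [k] containing [x]; the atoms of level [N]
   are points. *)
Section Filtration.
Context {R : realType} {T : finType} (l : nat -> T -> nat) (N : nat).

Definition atom_size k x := #|[pred y | l k y == l k x]|.

Definition avg {K : numFieldType} k (F : T -> K) x : K :=
  (\sum_(y | l k y == l k x) F y) / (atom_size k x)%:R.

(** The conditional expectation of [F] given the sigma-algebra of events prior to [tau]. *)
Definition stop {K : numFieldType} (tau : T -> nat) (F : T -> K) x : K :=
  avg (tau x) F x.

(** Pointwise form of the requirement that each event [tau = k] be a union of atoms of level [k]. *)
Definition stopping (tau : T -> nat) :=
  forall x y, l (tau x) y = l (tau x) x -> tau y = tau x.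

Hypothesis l_ref : forall k x y, l k.+1 x = l k.+1 y -> l k x = l k y.
Hypothesis l0 : forall x y, l 0 x = l 0 y.
Hypothesis lN : injective (l N).
Hypothesis l_reg : forall k x, (atom_size k x <= 2 * atom_size k.+1 x)%N.

Lemma label_le {k m x y} : (k <= m)%N -> l m x = l m y -> l k x = l k y.
Proof.
move=> /subnK <-; elim: (m - k)%N => // d IH /l_ref; exact: IH.
Qed.

Lemma atom_size_gt0 k x : (0 < atom_size k x)%N.
Proof. by apply/card_gt0P; exists x; rewrite inE. Qed.

Lemma atom_size_neq0 (K : numFieldType) k x : (atom_size k x)%:R != 0 :> K.
Proof. by rewrite pnatr_eq0 -lt0n atom_size_gt0. Qed.

Lemma atom_size_label k x y : l k x = l k y -> atom_size k x = atom_size k y.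
Proof. by rewrite /atom_size => ->. Qed.

Lemma avg_label (K : numFieldType) k (F : T -> K) x y :
  l k x = l k y -> avg k F x = avg k F y.
Proof. by rewrite /avg /atom_size => ->. Qed.

Lemma avg_cst (K : numFieldType) k (F : T -> K) x c :
  (forall y, l k y = l k x -> F y = c) -> avg k F x = c.
Proof.
move=> Fc; rewrite /avg (eq_bigr (fun=> c)); last by move=> y /eqP/Fc.
by rewrite sumr_const -[c *+ _]mulr_natr mulfK ?atom_size_neq0.
Qed.

Lemma avgN_id (K : numFieldType) (F : T -> K) x : avg N F x = F x.
Proof. by apply: avg_cst => y /lN ->. Qed.

Lemma avgB (K : numFieldType) k (F G : T -> K) x :
  avg k (fun y => F y - G y) x = avg k F x - avg k G x.
Proof. by rewrite /avg sumrB mulrBl. Qed.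

Lemma cmod_avg k (F : T -> R[i]) x :
  cmod (avg k F x) <= avg k (fun y => cmod (F y)) x.
Proof. by rewrite /avg cmodM cmodV_nat ler_wpM2r ?invr_ge0// cmod_sum. Qed.

(** By regularity the smaller atom has at least half the points of the larger one, and its sum is no
    larger since [F] is nonnegative. *)
Lemma avg_succ_le k (F : T -> R) x : (forall y, 0 <= F y) ->
  avg k.+1 F x <= 2 * avg k F x.
Proof.
move=> F0; rewrite /avg.
apply: (@le_trans _ _ ((\sum_(y | l k y == l k x) F y) / (atom_size k.+1 x)%:R)).
  rewrite ler_wpM2r ?invr_ge0// big_mkcond [leRHS]big_mkcond/=.
  apply: ler_sum => y _; case: eqP => [/l_ref ->|_]; first by rewrite eqxx.
  by case: ifP.
rewrite mulrCA ler_wpM2l ?sumr_ge0// ler_pdivlMr ?ltr0n ?atom_size_gt0//.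
rewrite mulrC ler_pdivrMr ?ltr0n ?atom_size_gt0//.
by rewrite -natrM ler_nat.
Qed.

(** * Conditioning at a stopping time *)

Section Stop.
Variable tau : T -> nat.
Hypothesis tauS : stopping tau.

(** The condition on [P] makes it a union of stopped atoms. Exchanging the sums, each [F y] is
    shared equally among the points of its own stopped atom. *)
Lemma sum_stop (K : numFieldType) (F : T -> K) (P : pred T) :
  (forall x y, P x -> l (tau x) y = l (tau x) x -> P y) ->
  \sum_(x | P x) stop tau F x = \sum_(x | P x) F x.
Proof.
move=> PS; rewrite /stop /avg.
under eq_bigr do rewrite mulr_suml.
rewrite (exchange_big_dep P)/=; last by move=> x y Px /eqP; exact: PS.
apply: eq_bigr => y Py.
rewrite (eq_big (fun x => l (tau y) x == l (tau y) y)
   (fun=> F y / (atom_size (tau y) y)%:R)).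
- by rewrite sumr_const -[_ *+ _]mulr_natr divfK ?atom_size_neq0.
- move=> x; apply/andP/eqP => [[Px /eqP e]|e].
    by rewrite (tauS e) e.
  by rewrite (tauS e) e eqxx; split => //; exact: PS Py e.
- move=> x /andP[Px /eqP e]; rewrite (tauS e); congr (_ / _%:R).
  by apply: atom_size_label; rewrite e.
Qed.

(* Optional stopping: conditioning the stopped function stops the martingale. *)
Lemma avg_stop (K : numFieldType) k (F : T -> K) x :
  avg k (stop tau F) x = avg (minn k (tau x)) F x.
Proof.
have [tk|kt] := leqP (tau x) k.
  apply: avg_cst => y /(label_le tk) e.
  by rewrite /stop (tauS e); apply: avg_label.
rewrite /avg; congr (_ / _); apply: sum_stop => y z /eqP yx zy.
apply/eqP; have [tyk|kty] := leqP (tau y) k.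
  have e : l (tau y) x = l (tau y) y by exact/esym/(label_le tyk).
  by move: kt; rewrite (tauS e) ltnNge tyk.
by rewrite -yx; apply: label_le zy; exact: ltnW.
Qed.

Lemma cmod_stop (F : T -> R[i]) x :
  cmod (stop tau F x) <= stop tau (fun y => cmod (F y)) x.
Proof. exact: cmod_avg. Qed.

Lemma sum_cmod_stop (F : T -> R[i]) (P : pred T) :
  (forall x y, P x -> l (tau x) y = l (tau x) x -> P y) ->
  \sum_(x | P x) cmod (stop tau F x) <= \sum_(x | P x) cmod (F x).
Proof.
move=> PS; rewrite -(sum_stop (fun x => cmod (F x)) PS).
by apply: ler_sum => x _; exact: cmod_stop.
Qed.

End Stop.

(** * First hitting times of adapted events *)

Section Hitting.
Variable s : nat -> T -> bool.
Hypothesis sA : forall k x y, l k x = l k y -> s k x = s k y.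

(* The value [N] means that [s] does not occur before time [N]. *)
Definition hit x := find (s^~ x) (iota 0 N).

Lemma hit_le x : (hit x <= N)%N.
Proof. by rewrite -[leqRHS](size_iota 0) find_size. Qed.

Lemma hitP x : (hit x < N)%N -> s (hit x) x.
Proof.
move=> h; have hs : has (s^~ x) (iota 0 N) by rewrite has_find size_iota.
by have := nth_find 0%N hs; rewrite nth_iota.
Qed.

Lemma before_hit k x : (k < hit x)%N -> s k x = false.
Proof.
move=> kh; have := before_find 0%N kh.
by rewrite nth_iota// (leq_trans kh) ?hit_le.
Qed.

Lemma hit_leq k x : (k < N)%N -> s k x -> (hit x <= k)%N.
Proof. by move=> kN sk; rewrite leqNgt; apply/negP => /before_hit; rewrite sk. Qed.

Lemma hit_stopping : stopping hit.
Proof.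
move=> x y e; apply/eqP; rewrite eqn_leq; apply/andP; split.
  have [hN|/(leq_trans (hit_le y))//] := ltnP (hit x) N.
  by apply: hit_leq => //; rewrite (sA e) hitP.
rewrite leqNgt; apply/negP => yx.
have := before_hit yx; rewrite -(sA (label_le (ltnW yx) e)) hitP//.
by apply: leq_trans yx (hit_le x).
Qed.

Lemma stop_hit_ge (K : numFieldType) (F : T -> K) x :
  ~~ (hit x < N)%N -> stop hit F x = F x.
Proof.
rewrite -leqNgt => h; rewrite /stop.
by have /eqP -> : hit x == N; [rewrite eqn_leq hit_le|rewrite avgN_id].
Qed.

Lemma hit_lt_closed x y : (hit x < N)%N -> l (hit x) y = l (hit x) x -> (hit y < N)%N.
Proof. by move=> h /hit_stopping ->. Qed.

End Hitting.

(** Doob's maximal inequality: [f] and its stopped version have the same sum over the stopped set,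
    where the stopped version is at least [t]. *)
Lemma hit_count_le (s : nat -> T -> bool) (t : R) (f : T -> R) :
  (forall k x y, l k x = l k y -> s k x = s k y) ->
  (forall k x, (k < N)%N -> s k x -> t <= avg k f x) ->
  t * \sum_x (hit s x < N)%:R <= \sum_(x | (hit s x < N)%N) f x.
Proof.
move=> sA sf; have hS := hit_stopping sA.
rewrite -(sum_stop hS f); last exact: hit_lt_closed.
rewrite mulr_sumr [leRHS]big_mkcond/=; apply: ler_sum => x _.
case: ifP => [h|_]; last by rewrite mulr0.
by rewrite mulr1; apply: sf => //; exact: hitP.
Qed.

(** * Maximal transforms *)

Section Transform.
Variables (M : nat) (A : 'M[R[i]]_(M, N)).
Implicit Types F G : T -> R[i].

(** Truncation keeps the differences up to level [n], so the value depends only on the atom of level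
    [n]; [n = N] gives the full transform. *)
Definition transform j n F x : R[i] :=
  \sum_(k < N | (k < n)%N) A j k * (avg k.+1 F x - avg k F x).

Definition maxT n F x : R := \big[Num.max/0]_(j < M) cmod (transform j n F x).

Lemma maxT_ge0 n F x : 0 <= maxT n F x.
Proof. exact: bigmax_ge_id. Qed.

Lemma maxT0 F x : maxT 0 F x = 0.
Proof.
apply/le_anti; rewrite maxT_ge0 andbT; apply: bigmax_le => // j _.
by rewrite /transform big_pred0 ?cmod0.
Qed.

Lemma maxT_label n F x y : l n x = l n y -> maxT n F x = maxT n F y.
Proof.
move=> e; apply: eq_bigr => j _; congr cmod; apply: eq_bigr => k kn.
by rewrite (avg_label F (label_le kn e)) (avg_label F (label_le (ltnW kn) e)).
Qed.

(** By optional stopping the differences before [tau] are unchanged, and in the later ones both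
    averages are the one taken at time [tau]. *)
Lemma transform_stop tau j n F x : stopping tau ->
  transform j n (stop tau F) x = transform j (minn n (tau x)) F x.
Proof.
move=> tS; rewrite /transform big_mkcond [RHS]big_mkcond/=.
apply: eq_bigr => k _; rewrite leq_min !avg_stop//.
case: (ltnP k n) => //= _; case: (ltnP k (tau x)) => h.
  by rewrite (minn_idPl h).
by rewrite (minn_idPr (leqW h)) subrr mulr0.
Qed.

Lemma maxT_stop tau n F x : stopping tau ->
  maxT n (stop tau F) x = maxT (minn n (tau x)) F x.
Proof. by move=> tS; apply: eq_bigr => j _; rewrite transform_stop. Qed.

(** Linearity: the transform of the stopped part of [F] is the truncated transform of [F]. *)
Lemma maxT_sub_stop tau n F x : stopping tau ->
  maxT n F x <=
    maxT n (fun y => F y - stop tau F y) x + maxT (minn n (tau x)) F x.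
Proof.
move=> tS; apply: bigmax_le; first by rewrite addr_ge0 ?maxT_ge0.
move=> j _; have -> : transform j n F x =
    transform j n (fun y => F y - stop tau F y) x +
    transform j (minn n (tau x)) F x.
  rewrite -(transform_stop j n F x tS) /transform -big_split/=.
  by apply: eq_bigr => k _; rewrite !avgB -mulrDr; congr (_ * _); ring.
apply: le_trans (cmodD _ _) _; apply: lerD.
  exact: (le_bigmax _ (fun j => cmod (transform j n _ x))).
exact: (le_bigmax _ (fun j => cmod (transform j _ F x))).
Qed.

(** * From weak type (q,q) to the good-lambda inequality *)

Section WeakType.
Variables (q c : R).
Hypotheses (q1 : 1 < q) (c0 : 0 < c).
Hypothesis weak_q : forall F t, 0 < t ->
  t `^ q * \sum_x (c * t < maxT N F x)%R%:R <= \sum_x cmod (F x) `^ q.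

Let K1 : R := 1 + 2 `^ (q - 1).

(* Calderon-Zygmund decomposition: the good part is [F] stopped when the
   averages of [|F|] exceed [t]; regularity bounds it by [2 * t], and the bad
   part only affects the transform after the stopping time. *)
Lemma weak_type11 F t : 0 < t ->
  t * \sum_x (c * t < maxT N F x)%R%:R <= K1 * \sum_x cmod (F x).
Proof.
move=> t0; pose f x := cmod (F x); have q0 : 0 < q by exact: lt_trans q1.
have f0 x : 0 <= f x by exact: cmod_ge0.
have S0 : 0 <= \sum_x f x by rewrite sumr_ge0.
(* If the global mean exceeds [t], counting all points is enough. Otherwise [no] settles the case
   [hit s x = 0] in [Gle], where there is no earlier level to compare with. *)
have [/existsP[x hx]|/existsPn no] := boolP [exists x, t < avg 0 f x].
  apply: (@le_trans _ _ (\sum_x f x)); last first.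
    by rewrite ler_peMl// /K1 lerDl powR_ge0.
  move: hx; rewrite /avg ltr_pdivlMr ?ltr0n ?atom_size_gt0// => /ltW.
  rewrite (eq_bigl xpredT); last by move=> y; apply/eqP/l0.
  apply: le_trans; rewrite ler_wpM2l ?(ltW t0)//.
  rewrite -natr_sum ler_nat /atom_size (eq_card (B := predT)); last first.
    by move=> y; rewrite !inE; apply/eqP/l0.
  by rewrite -sum1_card; apply: leq_sum => y _; case: (_ < _).
pose s k x := t < avg k f x.
have sA k x y : l k x = l k y -> s k x = s k y.
  by move=> e; rewrite /s (avg_label f e).
have hS := hit_stopping sA.
pose G := stop (hit s) F.
have Gle x : cmod (G x) <= 2 * t.
  apply: le_trans (cmod_stop _ _ _) _; rewrite /stop.
  case E: (hit s x) => [|k].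
    by have := no x; rewrite -leNgt => /le_trans; apply; lra.
  apply: le_trans (avg_succ_le _ _ f0) _; rewrite ler_pM2l//.
  by have := @before_hit s k x; rewrite E ltnSn => /(_ isT)/negbT; rewrite -leNgt.
have split_count : \sum_x (c * t < maxT N F x)%R%:R <=
    \sum_x (hit s x < N)%:R + \sum_x (c * t < maxT N G x)%R%:R :> R.
  rewrite -big_split/=; apply: ler_sum => x _.
  rewrite maxT_stop//; have [h|h] := ltnP (hit s x) N.
    by rewrite -natrD ler_nat; apply: leq_trans (leq_addr _ _); case: (_ < _).
  by rewrite add0r.
have bad : t * \sum_x (hit s x < N)%:R <= \sum_x f x.
  apply: le_trans (hit_count_le sA (f := f) _) _; first by move=> k x _ /ltW.
  by rewrite [leRHS](bigID (fun x => (hit s x < N)%N))/= lerDl sumr_ge0.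
have good : t * \sum_x (c * t < maxT N G x)%R%:R <= 2 `^ (q - 1) * \sum_x f x.
  (* The factor [t]^ (q - 1)[produces the left side of]weak_q[; the bound]2 * t[on]G[then trades all
     but one power of its modulus for](2 * t) [^ (q - 1)]. *)
  rewrite -(@ler_pM2l _ (t `^ (q - 1))) ?powR_gt0// mulrA.
  rewrite [_ * t]mulrC (mulr_powRB1 (ltW t0) q0).
  apply: le_trans (weak_q G t0) _.
  apply: (@le_trans _ _ (\sum_x (2 * t) `^ (q - 1) * cmod (G x))).
    apply: ler_sum => x _.
    rewrite -(mulr_powRB1 (cmod_ge0 _) q0).
    rewrite mulrC ler_wpM2r ?cmod_ge0//.
    apply: (ge0_ler_powR _ _ _ (Gle x)); rewrite ?nnegrE ?cmod_ge0//.
      by rewrite subr_ge0 ltW.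
    by rewrite mulr_ge0 // ltW.
  rewrite -mulr_sumr powRM ?(ltW t0)// -mulrA mulrCA.
  apply: ler_wpM2l; first exact: powR_ge0.
  apply: ler_wpM2l; first exact: powR_ge0.
  exact: (sum_cmod_stop hS).
by rewrite /K1 mulrDl mul1r (le_trans (ler_wpM2l (ltW t0) split_count))// mulrDr lerD.
Qed.

Definition exceeds t F x := [exists n : 'I_N.+1, t < maxT n F x].

(** Stop [F] when a truncated transform first exceeds [c * t]: the full transform of the stopped
    function is the truncated one at that time, and stopping does not increase the sum of moduli. *)
Lemma weak_type11_max F t : 0 < t ->
  t * \sum_x (exceeds (c * t) F x)%:R <= K1 * \sum_x cmod (F x).
Proof.
move=> t0; pose s n x := c * t < maxT n F x.
have sA k x y : l k x = l k y -> s k x = s k y.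
  by move=> e; rewrite /s (maxT_label F e).
have hS := hit_stopping sA.
apply: (@le_trans _ _ (K1 * \sum_x cmod (stop (hit s) F x))); last first.
  rewrite ler_wpM2l ?addr_ge0 ?powR_ge0//.
  exact: (sum_cmod_stop hS).
apply: le_trans (weak_type11 _ t0); rewrite ler_wpM2l ?(ltW t0)//.
apply: ler_sum => x _; rewrite ler_nat.
case: (boolP (exceeds _ _ _)) => [/existsP[n sn]|//].
rewrite maxT_stop// (minn_idPr (hit_le s x)).
have [h|h] := ltnP (hit s x) N; first by rewrite [_ < _](hitP h).
(* The default value [N] only says that no level below [N] exceeds [c * t], so the witness [n] must
   be [N] itself. *)
have e : hit s x = N by apply/eqP; rewrite eqn_leq hit_le.
have [nN|Nn] := ltnP n N.
  by have := @hit_leq s n x nN sn; rewrite e leqNgt nN.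
have <- : n = hit s x :> nat by rewrite e; apply/eqP; rewrite eqn_leq Nn -ltnS ltn_ord.
by rewrite sn.
Qed.

(** Looks one level ahead: the event concerns the transform of level [n.+1], yet it is determined by
    the atom of level [n]. *)
Definition pred_hit t F n x := [exists y, (l n y == l n x) && (t < maxT n.+1 F y)].

Definition pred_exceeds t F x := [exists n : 'I_N, pred_hit t F n x].

Lemma pred_hit_adapted t F n x y : l n x = l n y ->
  pred_hit t F n x = pred_hit t F n y.
Proof. by rewrite /pred_hit => ->. Qed.

Lemma pred_exceedsE t F x : pred_exceeds t F x = (hit (pred_hit t F) x < N)%N.
Proof.
apply/existsP/idP => [[n h]|h]; last by exists (Ordinal h); exact: hitP.
by apply: leq_ltn_trans (ltn_ord n); exact: hit_leq.
Qed.

(** When [pred_hit] occurs, the transform exceeds the level on a whole child of the atom. By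
    regularity [exceeds] has density at least one half there, and the maximal inequality for its
    indicator costs a factor 2. *)
Lemma weak_type11_pred F t : 0 < t ->
  t * \sum_x (pred_exceeds (c * t) F x)%:R <= 2 * K1 * \sum_x cmod (F x).
Proof.
move=> t0; pose g x : R := (exceeds (c * t) F x)%:R.
have g0 x : 0 <= g x by [].
have half k x : (k < N)%N -> pred_hit (c * t) F k x -> 2^-1 <= avg k g x.
  move=> kN /existsP[y /andP[/eqP yx hy]].
  rewrite -(avg_label g yx); have := avg_succ_le k y g0.
  rewrite (@avg_cst _ _ _ _ 1); first by lra.
  move=> z zy; rewrite /g; suff -> : exceeds (c * t) F z by [].
  apply/existsP; exists (Ordinal (kN : (k.+1 < N.+1)%N)).
  by rewrite /= (maxT_label F zy).
pose s := pred_hit (c * t) F.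
have h1 := hit_count_le (@pred_hit_adapted (c * t) F) half.
have h2 : \sum_(x | (hit s x < N)%N) g x <= \sum_x g x.
  by rewrite [leRHS](bigID (fun x => (hit s x < N)%N))/= lerDl sumr_ge0.
have h3 := weak_type11_max F t0.
under eq_bigr do rewrite pred_exceedsE.
have h4 : \sum_x (hit s x < N)%:R <= 2 * \sum_x g x.
  by have := le_trans h1 h2; rewrite -/s mulrC ler_pdivrMr// mulrC.
apply: le_trans (ler_wpM2l (ltW t0) h4) _; rewrite mulrCA -mulrA.
by rewrite ler_pM2l.
Qed.

(* Before the predictable stopping time the transforms are at most [c * t],
   so no jump has to be controlled. *)
Lemma good_lambda F t : 0 < t ->
  t * \sum_x (pred_exceeds (2 * (c * t)) F x)%:R <=
    4 * K1 * \sum_x (pred_exceeds (c * t) F x)%:R * cmod (F x).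
Proof.
move=> t0; have ct0 : 0 < c * t by rewrite mulr_gt0.
pose s := pred_hit (c * t) F.
have sA k x y : l k x = l k y -> s k x = s k y by exact: pred_hit_adapted.
have hS := hit_stopping sA.
pose G x := F x - stop (hit s) F x.
(* The transform of [F] is at most [c * t] up to the hitting time, so the excess over [2 * (c * t)]
   leaves more than [c * t] for the transform of [G]. *)
have incl x : pred_exceeds (2 * (c * t)) F x -> pred_exceeds (c * t) G x.
  case/existsP=> n /existsP[y /andP[yx hy]].
  apply/existsP; exists n; apply/existsP; exists y; rewrite yx/=.
  have hyn : (hit s y <= n)%N.
    apply: hit_leq => //; apply/existsP; exists y; rewrite eqxx/=.
    by apply: le_lt_trans hy; rewrite ler_peMl ?ler1n// ltW.
  have := maxT_sub_stop n.+1 F y hS; rewrite (minn_idPr (leqW hyn)).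
  have : maxT (hit s y) F y <= c * t.
    (* Since [pred_hit] looks ahead, its failure at level [m] bounds the transform of level [m.+1],
       the hitting time itself. *)
    case E: (hit s y) => [|m]; first by rewrite maxT0 ltW.
    have := @before_hit s m y; rewrite E ltnSn => /(_ isT)/negbT/existsPn/(_ y).
    by rewrite eqxx/= -leNgt.
  move=> le1 le2; have := lt_le_trans hy (le_trans le2 (lerD (lexx _) le1)).
  by rewrite mulr_natl mulr2n ltrD2r.
apply: (@le_trans _ _ (2 * K1 * \sum_x cmod (G x))).
  apply: le_trans _ (weak_type11_pred G t0); apply: ler_wpM2l; first exact: ltW.
  apply: ler_sum => x _; rewrite ler_nat.
  by case: (pred_exceeds (2 * _) _ _) (incl x) => // /(_ isT) ->.
have K10 : 0 <= K1 by rewrite addr_ge0 ?powR_ge0.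
(* One factor 2 comes from [weak_type11_pred], the other from the two terms of [G]. *)
have -> : 4 * K1 = 2 * K1 * 2 by rewrite mulrAC -natrM.
rewrite -[leRHS]mulrA ler_wpM2l ?mulr_ge0//.
have -> : \sum_x (pred_exceeds (c * t) F x)%:R * cmod (F x) =
    \sum_(x | (hit s x < N)%N) cmod (F x).
  rewrite [RHS]big_mkcond/=; apply: eq_bigr => x _; rewrite pred_exceedsE.
  by case: ifP; rewrite ?mul1r ?mul0r.
(* [G] vanishes off the stopped set; this localizes the right side. *)
rewrite (bigID (fun x => (hit s x < N)%N))/= [X in _ + X]big1 ?addr0; last first.
  by move=> x h; rewrite /G stop_hit_ge// subrr cmod0.
apply: (@le_trans _ _ (\sum_(x | (hit s x < N)%N) (cmod (F x) + cmod (stop (hit s) F x)))).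
  by apply: ler_sum => x _; exact: cmodB.
rewrite big_split/= mulr_natl mulr2n lerD2l.
by apply: (sum_cmod_stop hS); exact: hit_lt_closed.
Qed.

End WeakType.

(** The predictable majorant: for [t >= 0] its superlevel sets are the events [pred_exceeds t F]. *)
Definition pred_max F x : R :=
  \big[Num.max/0]_(n < N) \big[Num.max/0]_(y | l n y == l n x) maxT n.+1 F y.

Lemma pred_max_gt t F x : 0 <= t -> (t < pred_max F x) = pred_exceeds t F x.
Proof.
move=> t0; apply/bigmax_gtP/existsP => [[|[n _ /bigmax_gtP[|[y yx h]]]]|[n]].
- by rewrite ltNge t0.
- by rewrite ltNge t0.
- by exists n; apply/existsP; exists y; rewrite yx.
- move=> /existsP[y /andP[yx h]]; right; exists n => //.
  by apply/bigmax_gtP; right; exists y.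
Qed.

(** Level [N.-1] looks ahead to level [N], and [x] competes in its own atom; for [N = 0] the
    transform is zero. *)
Lemma maxT_le_pred_max F x : maxT N F x <= pred_max F x.
Proof.
rewrite leNgt; apply/negP => h.
have p0 : 0 <= pred_max F x by exact: bigmax_ge_id.
have N0 : (0 < N)%N.
  rewrite lt0n; apply/eqP => e.
  by move: h; rewrite e maxT0 ltNge p0.
have mN : (N.-1 < N)%N by rewrite prednK.
have : pred_exceeds (pred_max F x) F x.
  apply/existsP; exists (Ordinal mN); apply/existsP; exists x.
  by rewrite eqxx/= prednK.
by rewrite -pred_max_gt// ltxx.
Qed.

End Transform.

End Filtration.

(** Dividing the predictable majorant by [c] frees the good-lambda constant of [c], so that [C]
    depends on [p] and [q] only. *)
Lemma transform_strong_of_weak {R : realType} (p q : R) : 1 < p -> 1 < q ->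
  exists C : R, 0 < C /\
  forall (T : finType) (l : nat -> T -> nat) (N : nat),
    (forall k x y, l k.+1 x = l k.+1 y -> l k x = l k y) ->
    (forall x y, l 0%N x = l 0%N y) ->
    injective (l N) ->
    (forall k x, (atom_size l k x <= 2 * atom_size l k.+1 x)%N) ->
  forall (M : nat) (A : 'M[R[i]]_(M, N)) (c : R), 0 < c ->
    (forall F t, 0 < t ->
      t `^ q * \sum_x (c * t < maxT l A N F x)%R%:R <= \sum_x cmod (F x) `^ q) ->
  forall F : T -> R[i],
    \sum_x maxT l A N F x `^ p <= C * c `^ p * \sum_x cmod (F x) `^ p.
Proof.
move=> p1 q1; have K0 : 0 < 4 * (1 + 2 `^ (q - 1)) :> R.
  by rewrite mulr_gt0// ltr_pwDl// powR_ge0.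
have [C [C0 HC]] := good_lambda_norm_le p1 K0.
exists C; split => // T l N lr l0 lN lreg M A c c0 weak F.
pose X x := pred_max l A F x / c.
have pm0 x : 0 <= pred_max l A F x by exact: bigmax_ge_id.
have X0 x : 0 <= X x by rewrite divr_ge0 ?(ltW c0).
have gtE t x : 0 <= t -> (t < X x) = pred_exceeds l A (c * t) F x.
  by move=> t0; rewrite ltr_pdivlMr// mulrC pred_max_gt// mulr_ge0// ltW.
have H t : 0 < t -> t * \sum_x (2 * t < X x)%R%:R <=
    4 * (1 + 2 `^ (q - 1)) * \sum_x (t < X x)%R%:R * cmod (F x).
  move=> t0; have := good_lambda lr l0 lN lreg q1 c0 weak F t0.
  have -> : 2 * (c * t) = c * (2 * t) by rewrite mulrCA.
  under eq_bigr do rewrite -gtE ?mulr_ge0 ?(ltW t0)//.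
  by under [X in _ <= _ * X]eq_bigr do rewrite -gtE ?(ltW t0)//.
have := HC T X (fun x => cmod (F x)) X0 (fun x => cmod_ge0 _) H.
move=> /(ler_wpM2l (powR_ge0 c p)) h.
rewrite [C * _]mulrC -mulrA; apply: le_trans h; rewrite mulr_sumr.
apply: ler_sum => x _; rewrite -powRM ?(ltW c0)//.
apply: ge0_ler_powR; rewrite ?nnegrE ?maxT_ge0 ?mulr_ge0 ?invr_ge0 ?(ltW c0)//.
  by rewrite ltW// (lt_trans ltr01).
by rewrite /X mulrC divfK ?gt_eqF//; exact: maxT_le_pred_max.
Qed.

(** * The standard dyadic filtration of the unit interval *)

Section DyadicGrid.
Context {R : realType}.
Local Open Scope classical_set_scope.

Let mu := @lebesgue_measure R.

(** The absolute value only yields a natural number; for [0 <= x] this is the floor. *)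
Definition grid k (x : R) : nat := `|Num.floor (2 ^+ k * x)|%N.

Definition cell k (i : nat) : set R := `[i%:R / 2 ^+ k, i.+1%:R / 2 ^+ k[.

Lemma expr2_gt0 k : 0 < 2 ^+ k :> R.
Proof. exact: exprn_gt0. Qed.

Lemma grid_floor k x : 0 <= x -> (grid k x)%:Z = Num.floor (2 ^+ k * x).
Proof.
move=> x0; rewrite /grid gez0_abs// floor_ge0 mulr_ge0// ltW// expr2_gt0.
Qed.

Lemma grid_eq k x i : 0 <= x ->
  (grid k x == i) = (i%:R <= 2 ^+ k * x < i.+1%:R).
Proof.
move=> x0; have -> : (grid k x == i) = ((grid k x)%:Z == i%:Z) by [].
by rewrite grid_floor// floor_eq intrD -[i.+1%:R]natr1.
Qed.

Lemma cellE k i x : cell k i x <-> 0 <= x /\ grid k x = i.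
Proof.
rewrite /cell /= in_itv/= ler_pdivrMr ?expr2_gt0// ltr_pdivlMr ?expr2_gt0//.
rewrite ![x * _]mulrC; split=> [h|[x0 /eqP]]; last by rewrite grid_eq.
have x0 : 0 <= x.
  by have /andP[h1 _] := h; have := le_trans (ler0n _ _) h1; rewrite pmulr_rge0 ?expr2_gt0.
by split=> //; apply/eqP; rewrite grid_eq.
Qed.

Lemma OmegaE k x : Omega x <-> 0 <= x /\ (grid k x < 2 ^ k)%N.
Proof.
rewrite /Omega/= in_itv/=; split=> [/andP[x0 x1]|[x0 h]].
  split=> //; have /andP[h _] : (grid k x)%:R <= 2 ^+ k * x < (grid k x).+1%:R.
    by rewrite -grid_eq.
  rewrite -(ltr_nat R) natrX; apply: le_lt_trans h _.
  by rewrite gtr_pMr ?expr2_gt0.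
rewrite x0/=; have /andP[_ h2] : (grid k x)%:R <= 2 ^+ k * x < (grid k x).+1%:R.
  by rewrite -grid_eq.
rewrite -(@ltr_pM2l _ (2 ^+ k)) ?expr2_gt0// mulr1; apply: lt_le_trans h2 _.
by rewrite -natrX ler_nat.
Qed.

Lemma grid_div k n x : (k <= n)%N -> 0 <= x ->
  grid k x = (grid n x %/ 2 ^ (n - k))%N.
Proof.
move=> kn x0; set d := (2 ^ (n - k))%N.
have d0 : (0 < d)%N by rewrite expn_gt0.
have /andP[h1 h2] : (grid n x)%:R <= 2 ^+ n * x < (grid n x).+1%:R by rewrite -grid_eq.
have e : 2 ^+ n = d%:R * 2 ^+ k :> R by rewrite natrX -exprD subnK.
have dR : 0 < d%:R :> R by rewrite ltr0n.
apply/eqP; rewrite grid_eq//; apply/andP; split.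
  rewrite -(ler_pM2l dR) mulrA -e; apply: le_trans h1.
  by rewrite -natrM ler_nat mulnC leq_divM.
rewrite -(ltr_pM2l dR) mulrA -e; apply: lt_le_trans h2 _.
by rewrite -natrM ler_nat mulnC ltn_ceil.
Qed.

Lemma dyad_atomE k x y : Omega x ->
  dyad_atom k x y <-> Omega y /\ grid k y = grid k x.
Proof.
move=> Ox; have [x0 xk] := (OmegaE k x).1 Ox.
have -> : dyad_atom k x = cell k (grid k x).
  rewrite /dyad_atom /dyad_left /cell -grid_floor//; congr (`[_, _[).
  by rewrite -[(grid k x).+1%:R]natr1 mulrDl mul1r.
rewrite cellE (OmegaE k); split=> [[y0 e]|[[y0 _] e]]; last by [].
by rewrite e.
Qed.

Lemma measurable_cell k i : measurable (cell k i).
Proof. exact: measurable_itv. Qed.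

Lemma lebesgue_cell k i : mu (cell k i) = ((2 ^+ k)^-1)%:E.
Proof.
rewrite /mu /cell lebesgue_measure_itv/= lte_fin ltr_pM2r ?invr_gt0 ?expr2_gt0//.
rewrite ltr_nat ltnSn -EFinB; congr EFin.
by rewrite -mulrBl -natrB// subSnn mul1r.
Qed.

Lemma measurable_Omega : measurable (Omega : set R).
Proof. exact: measurable_itv. Qed.

Lemma cell_sub_Omega n (i : 'I_(2 ^ n)) : cell n i `<=` Omega.
Proof. by move=> x /cellE[x0 e]; apply/(OmegaE n); rewrite e. Qed.

Lemma integral_cells n (P : pred 'I_(2 ^ n)) (D : set R) (f : R -> R) :
  measurable_fun Omega f ->
  (forall x, D x <-> exists2 i, P i & cell n i x) ->
  (\int[mu]_(x in D) (f x)%:E =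
   \sum_(i | P i) \int[mu]_(x in cell n i) (f x)%:E)%E.
Proof.
move=> mf DE; set s := [seq i <- enum 'I_(2 ^ n) | P i].
have DU : D = \big[setU/set0]_(i <- s) cell n i.
  rewrite -bigcup_seq; apply/seteqP; split=> x.
    by move=> /DE[i Pi xi]; exists i => //=; rewrite mem_filter Pi mem_enum.
  by move=> [i/=]; rewrite mem_filter => /andP[Pi _] xi; apply/DE; exists i.
rewrite DU integral_bigsetU_EFin.
- by rewrite big_filter big_enum_cond.
- by move=> i; exact: measurable_cell.
- by rewrite filter_uniq// enum_uniq.
- move=> i j _ _ [x [/cellE[_ ei] /cellE[_ ej]]].
  by apply: val_inj; rewrite /= -ei -ej.
- apply/measurable_EFinP; rewrite -DU; apply: measurable_funS mf.
    exact: measurable_Omega.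
  by move=> x /DE[i _]; exact: cell_sub_Omega.
Qed.

(** * Functions constant on the cells of level [n], and the filtration of these cells *)

Section Grid.
Variable n : nat.

Lemma expn2_gt0 : (0 < 2 ^ n)%N. Proof. by rewrite expn_gt0. Qed.

(** The remainder makes the index total; on [Omega] it changes nothing. *)
Definition idx (x : R) : 'I_(2 ^ n) := Ordinal (ltn_pmod (grid n x) expn2_gt0).

Lemma idxE x : Omega x -> idx x = grid n x :> nat.
Proof. by move=> /(OmegaE n)[_ h]; rewrite /= modn_small. Qed.

Lemma cell_idx (i : 'I_(2 ^ n)) x : cell n i x <-> Omega x /\ idx x = i.
Proof.
split=> [xi|[Ox <-]].
  have Ox := cell_sub_Omega xi; split=> //.
  by apply: ord_inj; rewrite idxE//; case/cellE: xi.
by apply/cellE; rewrite idxE//; split=> //; case/(OmegaE n): Ox.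
Qed.

Lemma measurable_step (phi : 'I_(2 ^ n) -> R) :
  measurable_fun Omega (fun x => phi (idx x)).
Proof.
apply: (@measurable_funS _ _ _ _ (\bigcup_i cell n i)).
- by apply: bigcup_measurable => i _; exact: measurable_cell.
- by move=> x /(OmegaE n)[x0 _]; exists (grid n x) => //; apply/cellE.
- apply/measurable_fun_bigcup => i; first exact: measurable_cell.
  apply: (eq_measurable_fun (cst (phi (Ordinal (ltn_pmod i expn2_gt0))))).
    move=> x /set_mem/cellE[_ e] /=; congr phi; apply: val_inj.
    by rewrite /= e.
  exact: measurable_cst.
Qed.

Lemma integral_step_cell (phi : 'I_(2 ^ n) -> R) (i : 'I_(2 ^ n)) :
  (\int[mu]_(x in cell n i) (phi (idx x))%:E = (phi i / 2 ^+ n)%:E)%E.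
Proof.
rewrite (eq_integral (cst (phi i)%:E)); last first.
  by move=> x /set_mem/cell_idx[_ ->].
rewrite integral_cst; last exact: measurable_cell.
by rewrite [X in (_ * X)%E]lebesgue_cell.
Qed.

Lemma Omega_cells (x : R) : Omega x <-> exists2 i : 'I_(2 ^ n), xpredT i & cell n i x.
Proof.
split=> [Ox|[i _]]; last exact: cell_sub_Omega.
by exists (idx x) => //; apply/cell_idx.
Qed.

Lemma integral_step (phi : 'I_(2 ^ n) -> R) :
  (\int[mu]_(x in Omega) (phi (idx x))%:E = ((\sum_i phi i) / 2 ^+ n)%:E)%E.
Proof.
rewrite (integral_cells (measurable_step phi) Omega_cells).
under eq_bigr do rewrite integral_step_cell.
by rewrite sumEFin mulr_suml.
Qed.

Lemma measure_step (P : pred 'I_(2 ^ n)) :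
  mu (Omega `&` [set x | P (idx x)]) = ((\sum_i (P i)%:R) / 2 ^+ n)%:E.
Proof.
have mA : measurable (Omega `&` [set x | P (idx x)]).
  have -> : Omega `&` [set x | P (idx x)] =
     Omega `&` (fun x => (P (idx x))%:R : R) @^-1` [set 1].
    apply/seteqP; split=> x [Ox /= Px]; split=> //=; first by rewrite Px.
    by case: (P (idx x)) Px => // /esym/eqP; rewrite oner_eq0.
  apply: (measurable_step (fun i => (P i)%:R)); first exact: measurable_Omega.
  exact: measurable_set1.
have := integral_indic (@lebesgue_measure R) measurable_Omega mA.
rewrite setIAC setIid => h; apply: etrans (esym h) _.
rewrite -integral_step; apply: eq_integral => x /set_mem Ox.
by congr EFin; rewrite indicE; congr (nat_of_bool _)%:R; apply/idP/idP => [/set_mem[]|Px]; rewrite ?inE.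
Qed.

Lemma Lp_norm_step (p : R) (g : R -> R) (phi : 'I_(2 ^ n) -> R) :
  (forall i, 0 <= phi i) -> (forall x, Omega x -> g x = phi (idx x)) ->
  Lp_norm p g = (((\sum_i phi i `^ p) / 2 ^+ n) `^ p^-1)%:E.
Proof.
move=> phi0 gE; rewrite /Lp_norm -poweR_EFin; congr (_ `^ _)%E.
rewrite -(integral_step (fun i => phi i `^ p)); apply: eq_integral => x.
by move=> /set_mem/gE ->; rewrite ger0_norm.
Qed.

Lemma measure_gt_step (t : R) (g : R -> R) (phi : 'I_(2 ^ n) -> R) :
  (forall i, 0 <= phi i) -> (forall x, Omega x -> g x = phi (idx x)) ->
  mu (Omega `&` [set x | t < `|g x|]) =
    ((\sum_i (t < phi i)%R%:R) / 2 ^+ n)%:E.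
Proof.
move=> phi0 gE; rewrite -(measure_step (fun i => t < phi i)); congr (mu _).
by apply/seteqP; split=> x [Ox /=]; rewrite gE// ger0_norm.
Qed.

(** A cell of level [k <= n] consists of [2 ^ (n - k)] consecutive cells of level [n]; for [k >= n]
    truncated subtraction leaves [i] itself. *)
Definition label k (i : 'I_(2 ^ n)) : nat := (i %/ 2 ^ (n - k))%N.

Lemma label_ref k i j : label k.+1 i = label k.+1 j -> label k i = label k j.
Proof.
rewrite /label; have [kn|nk] := ltnP k n; last first.
  have -> : (n - k.+1 = 0)%N by apply/eqP; rewrite subn_eq0 leqW.
  by have -> : (n - k = 0)%N by apply/eqP; rewrite subn_eq0.
by rewrite -(subnSK kn) expnSr !divnMA => ->.
Qed.

Lemma label0 i j : label 0 i = label 0 j.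
Proof. by rewrite /label subn0 !divn_small. Qed.

Lemma labeln_inj : injective (label n).
Proof. by move=> i j; rewrite /label subnn !divn1 => /val_inj. Qed.

Lemma card_block m d a : (0 < d)%N -> (a.+1 * d <= m)%N ->
  #|[pred i : 'I_m | (i %/ d)%N == a]| = d.
Proof.
move=> d0 am; have lt_f (r : 'I_d) : (a * d + r < m)%N.
  by apply: leq_trans am; rewrite mulSn addnC ltn_add2r.
pose f (r : 'I_d) : 'I_m := Ordinal (lt_f r).
have f_inj : injective f.
  by move=> r s /(congr1 val)/= /addnI/val_inj.
rewrite -[RHS]card_ord -(card_codom f_inj); apply: eq_card => i.
rewrite !inE; apply/eqP/codomP => [e|[r ->]]; last first.
  by rewrite /= divnMDl// divn_small// addn0.
exists (Ordinal (ltn_pmod i d0)); apply: val_inj => /=.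
by rewrite -e -divn_eq.
Qed.

Lemma card_label_atom k i : atom_size label k i = (2 ^ (n - k))%N.
Proof.
apply: card_block; first by rewrite expn_gt0.
(* The exponent [n - (n - k)] stands for the minimum of [k] and [n], which covers levels beyond
   [n]. *)
have e : (2 ^ n = 2 ^ (n - (n - k)) * 2 ^ (n - k))%N.
  by rewrite -expnD subnK ?leq_subr.
rewrite [leqRHS]e leq_mul2r; apply/orP; right.
by rewrite ltn_divLR ?expn_gt0// -e.
Qed.

Lemma label_reg k i : (atom_size label k i <= 2 * atom_size label k.+1 i)%N.
Proof.
by rewrite !card_label_atom -expnS leq_exp2l// subnS leqSpred.
Qed.

End Grid.
End DyadicGrid.

(** * Replacing a function on the unit interval by its means over cells *)

Section Reduction.
Context {R : realType}.
Local Open Scope classical_set_scope.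

Let mu := @lebesgue_measure R.

Lemma normr_Re_le (z : R[i]) : `|complex.Re z| <= cmod z.
Proof. by rewrite -sqrtr_sqr ler_wsqrtr// lerDl sqr_ge0. Qed.

Lemma normr_Im_le (z : R[i]) : `|complex.Im z| <= cmod z.
Proof. by rewrite -sqrtr_sqr ler_wsqrtr// lerDr sqr_ge0. Qed.

Lemma cmod_le (z : R[i]) : cmod z <= `|complex.Re z| + `|complex.Im z|.
Proof.
rewrite -[leRHS]ger0_norm ?addr_ge0// -sqrtr_sqr ler_wsqrtr//.
rewrite sqrrD !real_normK ?num_real// lerD2r lerDl mulrn_wge0// mulr_ge0//.
Qed.

Lemma Re_divn (z : R[i]) m : complex.Re (z / m%:R) = complex.Re z / m%:R.
Proof.
have -> : (m%:R : R[i])^-1 = ((m%:R : R)^-1)%:C%C by rewrite fmorphV rmorph_nat.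
by case: z => a b; rewrite /= mulr0 subr0.
Qed.

Lemma Im_divn (z : R[i]) m : complex.Im (z / m%:R) = complex.Im z / m%:R.
Proof.
have -> : (m%:R : R[i])^-1 = ((m%:R : R)^-1)%:C%C by rewrite fmorphV rmorph_nat.
by case: z => a b; rewrite /= mulr0 add0r.
Qed.

Definition cell_mean n (f : R -> R[i]) (i : 'I_(2 ^ n)) : R[i] :=
  Complex (2 ^+ n * Rintegral mu (cell n i) (fun y => complex.Re (f y)))
          (2 ^+ n * Rintegral mu (cell n i) (fun y => complex.Im (f y))).

Lemma Rintegral_atom n k x (g : R -> R) : (k <= n)%N -> Omega x ->
  mu.-integrable Omega (EFin \o g) ->
  Rintegral mu (dyad_atom k x) g =
  \sum_(i : 'I_(2 ^ n) | label k i == label k (idx n x)) Rintegral mu (cell n i) g.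
Proof.
move=> kn Ox ig; rewrite /Rintegral.
rewrite (@integral_cells _ n (fun i : 'I_(2 ^ n) => label k i == label k (idx n x))).
- rewrite -sum_fine// => i _; apply: integrable_fin_num; first exact: measurable_cell.
  apply: integrableS ig; [exact: measurable_Omega|exact: measurable_cell|].
  exact: cell_sub_Omega.
- by case/integrableP: ig => /measurable_EFinP.
- move=> y; have lab z : Omega z -> label k (idx n z) = grid k z.
    by move=> Oz; rewrite /label idxE// -grid_div//; case/(OmegaE 0): Oz.
  rewrite dyad_atomE//; split=> [[Oy e]|[i /eqP e /cell_idx[Oy iE]]].
    by exists (idx n y); [rewrite !lab// e|apply/cell_idx].
  by split=> //; rewrite -!lab// iE.
Qed.

(** An atom of level [k] is a union of [2 ^ (n - k)] cells of level [n] of equal measure.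
    Integrability makes the integrals finite, so that their real values add up. *)
Lemma cond_exp_avg n k (f : R -> R[i]) x : (k <= n)%N -> Omega x ->
  mu.-integrable Omega (EFin \o (fun y => complex.Re (f y))) ->
  mu.-integrable Omega (EFin \o (fun y => complex.Im (f y))) ->
  cond_exp k f x = avg (@label n) k (@cell_mean n f) (idx n x).
Proof.
move=> kn Ox iRe iIm; rewrite /cond_exp !(Rintegral_atom kn Ox)//.
have e (a : R) : 2 ^+ k * a = 2 ^+ n * a / (2 ^ (n - k))%:R.
  have -> : 2 ^+ n = 2 ^+ k * 2 ^+ (n - k) :> R by rewrite -exprD subnKC.
  by rewrite natrX [_ * _ * a]mulrAC mulfK// expf_neq0.
apply/eqP; rewrite eq_complex /avg card_label_atom Re_divn Im_divn !raddf_sum/=.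
by rewrite !e !mulr_sumr !eqxx.
Qed.

Lemma max_transform_grid M N (A : 'M[R[i]]_(M, N)) (f : R -> R[i]) x : Omega x ->
  mu.-integrable Omega (EFin \o (fun y => complex.Re (f y))) ->
  mu.-integrable Omega (EFin \o (fun y => complex.Im (f y))) ->
  max_transform A f x = maxT (@label N) A N (@cell_mean N f) (idx N x).
Proof.
move=> Ox iRe iIm; apply: eq_bigr => j _; congr cmod.
rewrite /transform; apply: eq_big => [k|k _]; first by rewrite ltn_ord.
by rewrite /mart_diff !(@cond_exp_avg N)//= ltnW.
Qed.

(** Every function on the cells arises as a family of cell means, so a bound for all [f] can be
    tested on any finite [F]. *)
Lemma cell_mean_step n (F : 'I_(2 ^ n) -> R[i]) :
  @cell_mean n (fun x => F (idx n x)) =1 F.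
Proof.
move=> i; have e (a : R) : 2 ^+ n * (a / 2 ^+ n) = a.
  by rewrite mulrC divfK// gt_eqF// exprn_gt0.
rewrite /cell_mean /Rintegral.
rewrite (integral_step_cell (fun i => complex.Re (F i))).
rewrite (integral_step_cell (fun i => complex.Im (F i))) /= !e.
by case: (F i).
Qed.

Lemma integrable_step n (phi : 'I_(2 ^ n) -> R) :
  mu.-integrable Omega (EFin \o (fun x => phi (idx n x))).
Proof.
apply/integrableP; split.
  apply/measurable_EFinP.
  exact: (measurable_step phi).
by rewrite (integral_step (fun i => `|phi i|)) ltry.
Qed.

Lemma in_Lp_step (p : R) n (F : 'I_(2 ^ n) -> R[i]) :
  in_Lp p (fun x => F (idx n x)).
Proof.
split; [exact: (measurable_step (fun i => complex.Re (F i)))|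
        exact: (measurable_step (fun i => complex.Im (F i)))|].
rewrite (@Lp_norm_step _ n p _ (fun i => cmod (F i))) ?ltry// => i.
exact: cmod_ge0.
Qed.

(** * Integrability and cell means of a function in [L_p] *)

Section InLp.
Variables (p : R) (f : R -> R[i]).
Hypotheses (p1 : 1 < p) (fp : in_Lp p f).

Let p0 : 0 < p. Proof. exact: lt_trans p1. Qed.

Lemma measurable_cmod : measurable_fun Omega (fun x => cmod (f x)).
Proof.
have [mRe mIm _] := fp.
have -> : (fun x => cmod (f x)) =
    (fun y : R => y `^ 2^-1) \o
    (fun x => complex.Re (f x) ^+ 2 + complex.Im (f x) ^+ 2).
  by apply/funext => x /=; rewrite powR12_sqrt// addr_ge0 ?sqr_ge0.
apply: measurableT_comp; first exact: measurable_powR.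
by apply: measurable_funD; exact: measurable_funX.
Qed.

Lemma integrable_cmod_powR : mu.-integrable Omega (EFin \o (fun x => cmod (f x) `^ p)).
Proof.
apply/integrableP; split.
  apply/measurable_EFinP.
  exact: (measurableT_comp (measurable_powR p) measurable_cmod).
have pV : p^-1 != 0 by rewrite invr_neq0// gt_eqF.
have [_ _ /(lty_poweRy pV)] := fp; congr (_ < _)%E.
apply: eq_integral => x _ /=.
by rewrite ger0_norm ?cmod_ge0// ger0_norm ?powR_ge0.
Qed.

(** The modulus is at most 1 plus its [p]-th power, and [Omega] has finite measure. *)
Lemma integrable_cmod : mu.-integrable Omega (EFin \o (fun x => cmod (f x))).
Proof.
have i1 : mu.-integrable Omega
    ((EFin \o (fun=> 1%R)) \+ (EFin \o (fun x => (cmod (f x) `^ p)%R)))%E.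
  apply: integrableD; first exact: measurable_Omega.
    exact: (@integrable_step 0 (fun=> 1)).
  exact: integrable_cmod_powR.
apply: le_integrable i1; first exact: measurable_Omega.
  by apply/measurable_EFinP; exact: measurable_cmod.
move=> x _ /=; rewrite lee_fin (ger0_norm (cmod_ge0 _)) ger0_norm ?addr_ge0 ?powR_ge0//.
have [le1|/ltW ge1] := leP (cmod (f x)) 1; first by rewrite (le_trans le1)// lerDl powR_ge0.
by rewrite (le_trans (le1r_powR ge1 (ltW p1)))// lerDr.
Qed.

Lemma integrable_Re : mu.-integrable Omega (EFin \o (fun x => complex.Re (f x))).
Proof.
have [mRe _ _] := fp; apply: le_integrable integrable_cmod; first exact: measurable_Omega.
  by apply/measurable_EFinP.
by move=> x _ /=; rewrite lee_fin (ger0_norm (cmod_ge0 _)) normr_Re_le.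
Qed.

Lemma integrable_Im : mu.-integrable Omega (EFin \o (fun x => complex.Im (f x))).
Proof.
have [_ mIm _] := fp; apply: le_integrable integrable_cmod; first exact: measurable_Omega.
  by apply/measurable_EFinP.
by move=> x _ /=; rewrite lee_fin (ger0_norm (cmod_ge0 _)) normr_Im_le.
Qed.

Lemma integrable_cell n (i : 'I_(2 ^ n)) (h : R -> R) :
  mu.-integrable Omega (EFin \o h) -> mu.-integrable (cell n i) (EFin \o h).
Proof.
by apply: integrableS; [exact: measurable_Omega|exact: measurable_cell|
  exact: cell_sub_Omega].
Qed.

(** The factor 2 comes from bounding real and imaginary parts separately. *)
Lemma cmod_cell_mean_le n (i : 'I_(2 ^ n)) :
  cmod (cell_mean f i) <= 2 * (2 ^+ n * Rintegral mu (cell n i) (fun x => cmod (f x))).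
Proof.
apply: le_trans (cmod_le _) _; rewrite mulr_natl mulr2n /=.
have n0 : 0 <= 2 ^+ n :> R by rewrite exprn_ge0.
have bound (h : R -> R) : mu.-integrable Omega (EFin \o h) ->
    (forall x, `|h x| <= cmod (f x)) ->
    `|2 ^+ n * Rintegral mu (cell n i) h| <=
      2 ^+ n * Rintegral mu (cell n i) (fun x => cmod (f x)).
  move=> ih hg; rewrite normrM (ger0_norm n0) ler_wpM2l//.
  apply: (@le_trans _ _ (Rintegral mu (cell n i) (fun x => `|h x|))).
    by apply: le_normr_Rintegral; [exact: measurable_cell|exact: integrable_cell].
  apply: le_Rintegral => [|||x _]; first exact: measurable_cell.
  - exact: (integrable_norm (integrable_cell i ih)).
  - exact: integrable_cell integrable_cmod.
  - exact: hg.
by apply: lerD; apply: bound; [exact: integrable_Re|move=> x; exact: normr_Re_le|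
  exact: integrable_Im|move=> x; exact: normr_Im_le].
Qed.

(* A crude Jensen inequality: Young's inequality at the mean [m], integrated
   over the cell. *)
Lemma cell_mean_powR_le n (i : 'I_(2 ^ n)) :
  (2 ^+ n * Rintegral mu (cell n i) (fun x => cmod (f x))) `^ p <=
  2 * 2^-1 `^ (1 - p) * (2 ^+ n * Rintegral mu (cell n i) (fun x => cmod (f x) `^ p)).
Proof.
set I := Rintegral mu _ _; set J := Rintegral mu _ _; set m := 2 ^+ n * I.
have n0 : 0 < 2 ^+ n :> R by rewrite exprn_gt0.
have I0 : 0 <= I by apply: Rintegral_ge0 => x _; exact: cmod_ge0.
have m0 : 0 <= m by rewrite mulr_ge0// ltW.
have mC : @measurable _ (measurableTypeR R) (cell n i) by exact: measurable_cell.
have ig := integrable_cell i integrable_cmod.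
have igp := integrable_cell i integrable_cmod_powR.
have icst (a : R) : mu.-integrable (cell n i) (EFin \o (fun=> a)).
  exact: (integrable_cell i (@integrable_step 0 (fun=> a))).
have izl (a : R) (h : R -> R) : mu.-integrable (cell n i) (EFin \o h) ->
    mu.-integrable (cell n i) (EFin \o (fun x => a * h x)).
  exact: (integrableZl mC a).
have : Rintegral mu (cell n i) (fun x => m `^ (p - 1) * cmod (f x)) <=
       Rintegral mu (cell n i) (fun x => 2^-1 * m `^ p + 2^-1 `^ (1 - p) * cmod (f x) `^ p).
  apply: le_Rintegral => //.
  - exact: izl.
  - exact: (integrableD mC (icst _) (izl _ _ igp)).
  - by move=> x _; apply: powR_young_crude => //; exact: cmod_ge0.
rewrite RintegralZl// RintegralD//; last exact: izl.
rewrite Rintegral_cst// RintegralZl// -/I -/J.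
have -> : fine (mu (cell n i)) = (2 ^+ n)^-1 by exact: (congr1 fine (lebesgue_cell n i)).
move=> /(ler_wpM2l (ltW n0)).
have -> : 2 ^+ n * (m `^ (p - 1) * I) = m `^ p.
  by rewrite mulrCA -/m mulrC mulr_powRB1.
rewrite mulrDr mulrCA divff ?gt_eqF// mulr1.
have -> : 2 ^+ n * (2^-1 `^ (1 - p) * J) = 2^-1 `^ (1 - p) * (2 ^+ n * J) by rewrite mulrCA.
rewrite -[2 * _ * _]mulrA; move: (m `^ p) (_ * (2 ^+ n * J)) => a b; lra.
Qed.

Lemma sum_cell_mean_powR_le n :
  (\sum_i cmod (@cell_mean n f i) `^ p) / 2 ^+ n <=
  2 `^ p * (2 * 2^-1 `^ (1 - p)) * Rintegral mu Omega (fun x => cmod (f x) `^ p).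
Proof.
have n0 : 0 < 2 ^+ n :> R by rewrite exprn_gt0.
have -> : Rintegral mu Omega (fun x => cmod (f x) `^ p) =
    \sum_(i < 2 ^ n) Rintegral mu (cell n i) (fun x => cmod (f x) `^ p).
  rewrite /Rintegral (integral_cells _ (@Omega_cells _ n)); last first.
    by case/integrableP: integrable_cmod_powR => /measurable_EFinP.
  rewrite -sum_fine// => i _; apply: integrable_fin_num; first exact: measurable_cell.
  exact: integrable_cell integrable_cmod_powR.
rewrite ler_pdivrMr// mulrAC mulr_sumr; apply: ler_sum => i _.
rewrite -[leRHS]mulrA -[leRHS]mulrA.
apply: (@le_trans _ _ (2 `^ p * (2 ^+ n * Rintegral mu (cell n i) (fun x => cmod (f x))) `^ p)).
  have I0 : 0 <= Rintegral mu (cell n i) (fun x => cmod (f x)).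
    by apply: Rintegral_ge0 => x _; exact: cmod_ge0.
  rewrite -powRM ?mulr_ge0 ?(ltW n0)//.
  apply: ge0_ler_powR; rewrite ?nnegrE ?cmod_ge0 ?mulr_ge0 ?(ltW n0) ?(ltW p0)//.
  exact: cmod_cell_mean_le.
by apply: ler_wpM2l; [exact: powR_ge0|exact: cell_mean_powR_le].
Qed.

Lemma Lp_norm_cmod :
  Lp_norm p (fun x => cmod (f x)) =
  ((Rintegral mu Omega (fun x => cmod (f x) `^ p)) `^ p^-1)%:E.
Proof.
rewrite /Lp_norm -poweR_EFin; congr (_ `^ _)%E.
rewrite /Rintegral fineK; last first.
  by apply: (integrable_fin_num _ integrable_cmod_powR); exact: measurable_Omega.
by apply: eq_integral => x _; rewrite ger0_norm ?cmod_ge0.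
Qed.

End InLp.
End Reduction.

(** * Comparison of the strong and weak constants *)

Section Comparison.
Context {R : realType}.

Definition strong_bound (p : R) M N (A : 'M[R[i]]_(M, N)) (c : R) :=
  forall f, in_Lp p f ->
    (Lp_norm p (max_transform A f) <= c%:E * Lp_norm p (fun x => cmod (f x)))%E.

Definition weak_bound (p : R) M N (A : 'M[R[i]]_(M, N)) (c : R) :=
  forall f, in_Lp p f ->
    (weakLp_norm p (max_transform A f) <= c%:E * Lp_norm p (fun x => cmod (f x)))%E.

Lemma powR_invK (p x : R) : 0 < p -> 0 <= x -> (x `^ p^-1) `^ p = x.
Proof. by move=> p0 x0; rewrite -powRrM mulVf ?gt_eqF// powRr1. Qed.

Lemma powRK (p x : R) : 0 < p -> 0 <= x -> (x `^ p) `^ p^-1 = x.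
Proof. by move=> p0 x0; rewrite -powRrM mulfV ?gt_eqF// powRr1. Qed.

Lemma max_transform_in_Lp (p : R) M N (A : 'M[R[i]]_(M, N)) f x : 1 < p ->
  in_Lp p f -> Omega x ->
  max_transform A f x = maxT (@label N) A N (cell_mean f) (idx N x).
Proof.
move=> p1 fp Ox; apply: max_transform_grid => //.
  exact: (integrable_Re p1 fp).
exact: (integrable_Im p1 fp).
Qed.

(** Chebyshev's inequality, between finite sums because [g] is a step function. *)
Lemma weakLp_norm_le_Lp_norm (p : R) n (g : R -> R) (phi : 'I_(2 ^ n) -> R) :
  0 < p -> (forall i, 0 <= phi i) -> (forall x, Omega x -> g x = phi (idx n x)) ->
  (weakLp_norm p g <= Lp_norm p g)%E.
Proof.
move=> p0 phi0 gE; apply: ub_ereal_sup => _ [t /= t0 <-].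
rewrite (measure_gt_step t phi0 gE) (Lp_norm_step p phi0 gE) poweR_EFin -EFinM lee_fin.
have n0 : 0 <= (2 ^+ n)^-1 :> R by rewrite invr_ge0 exprn_ge0.
have S0 : 0 <= (\sum_i (t < phi i)%R%:R) / 2 ^+ n :> R.
  by rewrite mulr_ge0// sumr_ge0.
have Z0 : 0 <= (\sum_i phi i `^ p) / 2 ^+ n.
  by rewrite mulr_ge0// sumr_ge0// => i _; exact: powR_ge0.
rewrite -{1}(powRK p0 (ltW t0)) -powRM ?powR_ge0//.
apply: ge0_ler_powR; rewrite ?nnegrE ?invr_ge0 ?(ltW p0)//.
  by apply: mulr_ge0; first exact: powR_ge0.
rewrite mulrA ler_wpM2r// mulr_sumr; apply: ler_sum => i _.
case: ltP => [lt_t|_]; last by rewrite mulr0 powR_ge0.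
by rewrite mulr1; apply: ge0_ler_powR; rewrite ?nnegrE ?(ltW p0) ?(ltW t0)// ltW.
Qed.

Lemma strong_bound_weak (p : R) M N (A : 'M[R[i]]_(M, N)) (c : R) : 1 < p ->
  strong_bound p A c -> weak_bound p A c.
Proof.
move=> p1 sb f fp; apply: le_trans (sb f fp).
apply: (@weakLp_norm_le_Lp_norm p N _ (maxT (@label N) A N (cell_mean f))).
- exact: lt_trans p1.
- by move=> i; exact: maxT_ge0.
- by move=> x; exact: (max_transform_in_Lp A p1 fp).
Qed.

(** The weak bound is applied to the step function with values [F]; the common cell measure
    cancels. *)
Lemma weak_bound_finite (q : R) M N (A : 'M[R[i]]_(M, N)) (c : R) : 1 < q ->
  0 < c -> weak_bound q A c ->
  forall F t, 0 < t ->
    t `^ q * \sum_x (c * t < maxT (@label N) A N F x)%R%:R <=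
    \sum_x cmod (F x) `^ q.
Proof.
move=> q1 c0 wb F t t0; pose f (x : R) := F (idx N x).
have q0 : 0 < q by exact: lt_trans q1.
have fq : in_Lp q f by exact: in_Lp_step.
have gE x : Omega x -> max_transform A f x = maxT (@label N) A N F (idx N x).
  move=> Ox; rewrite (max_transform_in_Lp A q1 fq Ox).
  by congr maxT; apply/funext; exact: cell_mean_step.
have ct0 : 0 < c * t by rewrite mulr_gt0.
have n0 : 0 < 2 ^+ N :> R by rewrite exprn_gt0.
have n0' : 0 <= (2 ^+ N)^-1 :> R by rewrite invr_ge0 ltW.
have := wb f fq.
rewrite (@Lp_norm_step _ N q _ (fun i => cmod (F i))) => [|i|//]; last exact: cmod_ge0.
(* The level [c * t] in the supremum makes [c] cancel against the weak constant. *)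
have : ((c * t)%:E * (lebesgue_measure (Omega `&`
    [set x | (c * t < `|max_transform A f x|)%R])%classic `^ q^-1) <=
  weakLp_norm q (max_transform A f))%E.
  by apply: ereal_sup_ubound; exists (c * t).
rewrite (measure_gt_step _ (fun i => maxT_ge0 _ _ _ _ i) gE).
move=> /le_trans h /h; rewrite poweR_EFin -!EFinM lee_fin -mulrA ler_pM2l//.
set S := \sum_x _; set Z := \sum_x _.
have S0 : 0 <= S by rewrite sumr_ge0.
have Z0 : 0 <= Z by rewrite sumr_ge0// => x _; exact: powR_ge0.
move=> le1; have : (t * (S / 2 ^+ N) `^ q^-1) `^ q <= ((Z / 2 ^+ N) `^ q^-1) `^ q.
  apply: ge0_ler_powR le1; rewrite ?nnegrE ?(ltW q0) ?powR_ge0//.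
  by rewrite mulr_ge0 ?powR_ge0// ltW.
rewrite (powRM q (ltW t0) (powR_ge0 _ _)).
rewrite (powR_invK q0 (mulr_ge0 S0 n0')) (powR_invK q0 (mulr_ge0 Z0 n0')).
by rewrite mulrA ler_pM2r// invr_gt0.
Qed.

(** The finite transfer is applied to the cell means of [f]; [D] is the price of returning from them
    to [f]. *)
Lemma weak_bound_strong (p q : R) : 1 < p -> 1 < q ->
  exists K : R, 0 < K /\
  forall M N (A : 'M[R[i]]_(M, N)) (c : R), 0 < c ->
    weak_bound q A c -> strong_bound p A (K * c).
Proof.
move=> p1 q1; have p0 : 0 < p by exact: lt_trans p1.
have [C [C0 HC]] := transform_strong_of_weak p1 q1.
pose D : R := 2 `^ p * (2 * 2^-1 `^ (1 - p)).
have D0 : 0 < D by rewrite /D !mulr_gt0 ?powR_gt0 ?invr_gt0// ltr0n.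
exists ((C * D) `^ p^-1); split; first by apply: powR_gt0; exact: mulr_gt0.
move=> M N A c c0 wb f fp.
rewrite (Lp_norm_step p _ (fun x Ox => max_transform_in_Lp A p1 fp Ox)); last first.
  by move=> i; exact: maxT_ge0.
rewrite (Lp_norm_cmod p1 fp) -EFinM lee_fin.
set I := Rintegral _ _ _.
have I0 : 0 <= I by apply: Rintegral_ge0 => x _; exact: powR_ge0.
have := HC _ _ _ (@label_ref N) (@label0 N) (@labeln_inj N) (@label_reg N)
  _ A c c0 (weak_bound_finite q1 c0 wb) (cell_mean f).
set S := \sum_x _; set Z := \sum_x _ => h.
have cp : c = (c `^ p) `^ p^-1 by rewrite powRK// ltW.
rewrite [in leRHS]cp -!powRM ?powR_ge0 ?mulr_ge0 ?powR_ge0 ?(ltW C0) ?(ltW D0)//.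
have n0 : 0 <= (2 ^+ N)^-1 :> R by rewrite invr_ge0 exprn_ge0.
have S0 : 0 <= S by rewrite sumr_ge0// => x _; exact: powR_ge0.
apply: ge0_ler_powR; rewrite ?nnegrE ?invr_ge0 ?(ltW p0) ?mulr_ge0 ?powR_ge0 ?(ltW C0) ?(ltW D0)//.
apply: le_trans (ler_wpM2r n0 h) _.
have -> : C * D * c `^ p * I = C * c `^ p * (D * I) by ring.
rewrite -[leLHS]mulrA ler_wpM2l ?mulr_ge0 ?powR_ge0 ?(ltW C0)//.
exact: (sum_cell_mean_powR_le p1 fp).
Qed.

Lemma weak_bound_mono (q : R) M N (A : 'M[R[i]]_(M, N)) (c d : R) :
  c <= d -> weak_bound q A c -> weak_bound q A d.
Proof.
move=> cd wb f fq; apply: le_trans (wb f fq) _.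
by rewrite lee_wpmul2r ?lee_fin// poweR_ge0.
Qed.

Lemma h_weak_le_h_strong (p : R) M N (A : 'M[R[i]]_(M, N)) : 1 < p ->
  (h_weak p A <= h_strong p A)%E.
Proof.
move=> p1; apply: ereal_inf_le_tmp => _ [c [c0 sb] <-].
by exists c => //; split => //; exact: strong_bound_weak.
Qed.

Lemma h_strong_le_h_weak (p q : R) : 1 < p -> 1 < q ->
  exists K : R, 0 < K /\ forall M N (A : 'M[R[i]]_(M, N)),
    (h_strong p A <= K%:E * h_weak q A)%E.
Proof.
move=> p1 q1; have [K [K0 HK]] := weak_bound_strong p1 q1.
exists K; split => // M N A.
rewrite -lee_pdivrMl//; apply: le_ereal_inf_tmp => _ [c [c0 wb] <-].
(* An admissible [c] may be 0, whereas [weak_bound_strong] needs a positive one; enlarging it by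
   [e / K] costs [e]. *)
rewrite lee_pdivrMl// -EFinM; apply/lee_addgt0Pr => e e0.
have eK : 0 < e / K by rewrite divr_gt0.
have -> : ((K * c)%:E + e%:E = (K * (c + e / K))%:E)%E.
  by rewrite -EFinD mulrDr [K * (e / K)]mulrC divfK// gt_eqF.
apply: ereal_inf_lbound; exists (K * (c + e / K)) => //; split.
  by rewrite mulr_ge0 ?addr_ge0 ?(ltW K0) ?(ltW eK).
apply: HK; first by rewrite ltr_wpDl.
by apply: weak_bound_mono wb; rewrite lerDl ltW.
Qed.

Lemma h_weak_ge0 (p : R) M N (A : 'M[R[i]]_(M, N)) : (0 <= h_weak p A)%E.
Proof. by apply: le_ereal_inf_tmp => _ [c [c0 _] <-]; rewrite lee_fin. Qed.

End Comparison.

Unset Implicit Arguments.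

Theorem theorem2p1 (R : realType) (p q : R) :
  1 < p -> 1 < q ->
  exists C : R, 0 < C /\
    forall (M N : nat) (A : 'M[R[i]]_(M, N)),
      [/\ ((C^-1)%:E * h_strong p A <= h_weak q A)%E,
          (h_weak q A <= h_strong q A)%E &
          (h_strong q A <= C%:E * h_strong p A)%E].
Proof.
move=> p1 q1.
have [K1 [K10 HK1]] := h_strong_le_h_weak p1 q1.
have [K2 [K20 HK2]] := h_strong_le_h_weak q1 p1.
(* [K1] bounds [h_strong p] by [h_weak q], and [K2], with exponents exchanged, bounds [h_strong q]
   by [h_weak p], hence by [h_strong p]; the sum serves both. *)
exists (K1 + K2); split; first by rewrite addr_gt0.
move=> M N A; split; last first.
- apply: le_trans (HK2 _ _ A) _.
  apply: (@le_trans _ _ (K2%:E * h_strong p A)%E).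
    by rewrite lee_wpmul2l ?lee_fin ?(ltW K20)// h_weak_le_h_strong.
  rewrite lee_wpmul2r ?lee_fin ?lerDr ?(ltW K10)//.
  by apply: le_trans (h_weak_le_h_strong A p1); exact: h_weak_ge0.
- exact: h_weak_le_h_strong.
rewrite lee_pdivrMl ?addr_gt0//; apply: le_trans (HK1 _ _ A) _.
by rewrite lee_wpmul2r ?h_weak_ge0// lee_fin lerDl ltW.
Qed.
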